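(* Let $p>1$ be a real number, let $a,b:\mathbb{Z}\to(0,+\infty)$, and let $f:\mathbb{Z}\times\mathbb{R}\to\mathbb{R}$ be continuous, with $F(k,t)=\int_0^t f(k,s)\,ds$ for $k\in\mathbb{Z}$, $t\in\mathbb{R}$. Assume: (i) there is $b_0$ such that $b(k)\ge b_0>0$ for all $k\in\mathbb{Z}$, and $b(k)\to+\infty$ as $|k|\to+\infty$; (ii) $\lim_{t\to 0}\frac{|f(k,t)|}{|t|^{p-1}}=0$ uniformly for all $k\in\mathbb{Z}$; (iii) there are sequences $\{c_n\},\{d_n\}$ of real numbers such that $0<c_n<d_n<c_{n+1}$ for all $n\in\mathbb{N}$, $\lim_{n\to\infty}c_n=+\infty$, and $f(k,t)\le 0$ for every $k\in\mathbb{Z}$, $n\in\mathbb{N}$ and $t\in[c_n,d_n]$; (iv) for the sequence $\{d_n\}$ in (iii), there is $r<0$ such that $\sum_{k\in\mathbb{Z}}\sup_{t\in[r,d_n]}|F(k,t)|<+\infty$ for all $n\in\mathbb{N}$. Put $$B_{\pm}=\limsup_{(k,t)\to(\pm\infty,+\infty)}\frac{F(k,t)}{[a(k+1)+a(k)+b(k)]\,t^p},\qquad B_0=\sup_{k\in\mathbb{Z}}\left(\limsup_{t\to+\infty}\frac{F(k,t)}{[a(k+1)+a(k)+b(k)]\,t^p}\right),$$ and $B=\max\{B_+,B_-,B_0\}$, and assume that $B>0$ (the value $B=+\infty$ is allowed). Then, for any $\lambda>\frac{1}{Bp}$ (where $\frac{1}{Bp}=0$ if $B=+\infty$), the problem $$\begin{cases}-\Delta\left(a(k)\phi_p(\Delta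 u(k-1))\right)+b(k)\phi_p(u(k))=\lambda f(k,u(k)) & \text{for all } k\in\mathbb{Z},\\ u(k)\to 0 & \text{as } |k|\to\infty\end{cases}$$ admits a sequence of non-negative solutions in $X$ whose norms $\|\cdot\|$ tend to infinity.
   Context: Here $\phi_p(t)=|t|^{p-2}t$ for $t\in\mathbb{R}$ (with $\phi_p(0)=0$), and $\Delta$ is the forward difference operator, $\Delta u(k-1)=u(k)-u(k-1)$; thus $\Delta(a(k)\phi_p(\Delta u(k-1)))=a(k+1)\phi_p(u(k+1)-u(k))-a(k)\phi_p(u(k)-u(k-1))$. The parameter $\lambda$ is a positive real number. A solution is a function $u:\mathbb{Z}\to\mathbb{R}$; non-negative means $u(k)\ge 0$ for all $k\in\mathbb{Z}$. The space $X$ and its norm are $$X=\Big\{u:\mathbb{Z}\to\mathbb{R}\ :\ \sum_{k\in\mathbb{Z}}\left[a(k)|\Delta u(k-1)|^p+b(k)|u(k)|^p\right]<\infty\Big\},\qquad \|u\|=\Big(\sum_{k\in\mathbb{Z}}\left[a(k)|\Delta u(k-1)|^p+b(k)|u(k)|^p\right]\Big)^{1/p}.$$ The notation $\limsup_{(k,t)\to(\pm\infty,+\infty)}$ means the joint upper limit as $k\to\pm\infty$ in $\mathbb{Z}$ and $t\to+\infty$ in $\mathbb{R}$ simultaneously ($B_+$ for $k\to+\infty$, $B_-$ for $k\to-\infty$); these quantities take values in $[-\infty,+\infty]$. *)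

(* Defs.v *)
From HB Require Import structures.
From mathcomp Require Import all_boot all_order all_algebra.
From mathcomp Require Import all_classical all_reals all_analysis.

Set Implicit Arguments.
Unset Strict Implicit.
Unset Printing Implicit Defensive.

Import Order.TTheory GRing.Theory Num.Theory.
Import numFieldNormedType.Exports.

Local Open Scope classical_set_scope.
Local Open Scope ring_scope.

(* The library puts no topology on [int]; this alias carries the discrete one,
   which makes Z x R a topological space. *)
Notation dint := (discrete_topology int).

Definition int_pinfty : set_system int :=
  filter_from [set: int] (fun M => [set k | M <= k]).
Definition int_ninfty : set_system int :=
  filter_from [set: int] (fun M => [set k | k <= M]).
Definition int_infty : set_system int :=
  filter_from [set: int] (fun M => [set k | M <= `|k|]).

Global Instance int_pinfty_proper : ProperFilter int_pinfty.
Proof.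
apply: filter_from_proper => [|M _]; last by exists M => /=.
apply: filter_from_filter => [|M N _ _]; first by exists 0.
by exists (Num.max M N) => // k /=; rewrite ge_max => /andP.
Qed.

Global Instance int_ninfty_proper : ProperFilter int_ninfty.
Proof.
apply: filter_from_proper => [|M _]; last by exists M => /=.
apply: filter_from_filter => [|M N _ _]; first by exists 0.
by exists (Num.min M N) => // k /=; rewrite le_min => /andP.
Qed.

Global Instance int_infty_proper : ProperFilter int_infty.
Proof.
apply: filter_from_proper => [|M _]; last by exists M; exact: ler_norm.
apply: filter_from_filter => [|M N _ _]; first by exists 0.
by exists (Num.max M N) => // k /=; rewrite ge_max => /andP.
Qed.

Section difference_problem.
Context {R : realType}.
Implicit Types (p lambda t : R) (a b u : int -> R) (f : int -> R -> R).

(* At t = 0 the factor t gives the value 0, also when p < 2. *)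
Definition phi p t : R := `|t| `^ (p - 2) * t.

Definition Delta u (k : int) : R := u (k + 1) - u k.

(* The oriented integral of f k from 0 to t. *)
Definition primitive f (k : int) t : R :=
  if 0 <= t then \int[lebesgue_measure]_(s in `[0, t]) f k s
  else - \int[lebesgue_measure]_(s in `[t, 0]) f k s.

Definition modular p a b u : \bar R :=
  \esum_(k in [set: int])
    (a k * `|Delta u (k - 1)| `^ p + b k * `|u k| `^ p)%:E.

Definition X p a b : set (int -> R) := [set u | (modular p a b u < +oo)%E].

Definition normX p a b u : R := fine (modular p a b u) `^ p^-1.

Definition growth p a b f (k : int) t : \bar R :=
  (primitive f k t / ((a (k + 1) + a k + b k) * t `^ p))%:E.

Definition Bplus p a b f : \bar R :=
  limf_esup (fun z : dint * R => growth p a b f z.1 z.2)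
            (filter_prod int_pinfty (pinfty_nbhs R)).

Definition Bminus p a b f : \bar R :=
  limf_esup (fun z : dint * R => growth p a b f z.1 z.2)
            (filter_prod int_ninfty (pinfty_nbhs R)).

Definition Bzero p a b f : \bar R :=
  ereal_sup [set limf_esup (growth p a b f k) (pinfty_nbhs R) | k in [set: int]].

Definition Bmax p a b f : \bar R :=
  maxe (maxe (Bplus p a b f) (Bminus p a b f)) (Bzero p a b f).

Definition is_solution p a b f lambda u : Prop :=
  (forall k : int,
     - Delta (fun j => a j * phi p (Delta u (j - 1))) k + b k * phi p (u k)
     = lambda * f k (u k)) /\
  u @ int_infty --> (0 : R).

End difference_problem.

(* Main.v *)
(* Let F be the primitive of f and J(u) = ||u||^p / p - lambda sum_k F(k, u(k)).
   The box of all u with 0 <= u(k) <= d_n is compact for pointwise convergence,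
   and hypothesis (iv) makes J lower semicontinuous there, so J has a minimizer
   u_n on the box.  Moving one coordinate of u_n at a time gives the equation at
   every k: a value u_n(k) = d_n would be a maximum of u_n, where the one-sided
   derivative of J is positive because f(k, d_n) <= 0, and a value u_n(k) = 0 is
   harmless because (ii) forces f(k, 0) = 0.  Since lambda > 1 / (B p), J is
   unbounded below along sequences T delta_k, hence J(u_n) -> -oo; a bound on
   ||u_n|| would keep all u_n inside a fixed box, on which J is bounded below. *)
Require Import Defs.
From HB Require Import structures.
From mathcomp Require Import all_boot all_order all_algebra.
From mathcomp Require Import all_classical all_reals all_analysis.
From mathcomp Require Import lra ring zify.

Set Implicit Arguments.
Unset Strict Implicit.
Unset Printing Implicit Defensive.

Import Order.TTheory GRing.Theory Num.Theory.
Import numFieldNormedType.Exports.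

Local Open Scope classical_set_scope.
Local Open Scope ring_scope.

Section Energy.
Context {R : realType}.
Implicit Types (p x t lambda D : R) (g : R -> R).
Implicit Types (a b S u : int -> R) (f : int -> R -> R).

(** * The function [phi], and derivatives of the p-th power of the absolute value and of the
    primitive *)

Lemma phi0 p : phi p 0 = 0.
Proof. by rewrite /phi mulr0. Qed.

Lemma phiN p x : phi p (- x) = - phi p x.
Proof. by rewrite /phi normrN mulrN. Qed.

Lemma phi_ge0 p x : 0 <= x -> 0 <= phi p x.
Proof. by move=> x0; rewrite mulr_ge0// powR_ge0. Qed.

Lemma phi_gt0 p x : 0 < x -> 0 < phi p x.
Proof. by move=> x0; rewrite mulr_gt0// powR_gt0// normr_gt0 gt_eqF. Qed.

Lemma phi_powR p x : 0 < x -> phi p x = x `^ (p - 1).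
Proof.
move=> x0; rewrite /phi gtr0_norm// -{2}(powRr1 (ltW x0)).
rewrite -powRD ?(gt_eqF x0) ?implybT//; by congr (_ `^ _); ring.
Qed.

Lemma cvg_norm_powR0 q : 0 < q -> `|x| `^ q @[x --> (0 : R)] --> (0 : R).
Proof.
move=> q0; apply/cvgr0Pnorm_lt => e e0.
have d0 : 0 < e `^ q^-1 by rewrite powR_gt0.
have := @nbhs0_lt R R _ d0; apply: filterS => x xd.
rewrite ger0_norm ?powR_ge0//.
suff : `|x| `^ q < (e `^ q^-1) `^ q by rewrite -powRrM mulVf ?gt_eqF// powRr1// ltW.
by rewrite gt0_ltr_powR ?nnegrE ?powR_ge0.
Qed.

Lemma is_derive_norm_powR p x : 1 < p ->
  is_derive x 1 (fun y => `|y| `^ p) (p * phi p x).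
Proof.
move=> p1.
wlog x0 : x / 0 <= x => [ih|].
  have [/ih//|xlt0] := leP 0 x.
  have /ih Dx : 0 <= - x by rewrite oppr_ge0 ltW.
  have -> : (fun y : R => `|y| `^ p) = (fun y => `|y| `^ p) \o -%R.
    by apply/funext => y /=; rewrite normrN.
  have := @is_derive1_comp R (fun y => `|y| `^ p) -%R x _ _ Dx (is_deriveNid _ _).
  by rewrite mulrN1 phiN mulrN opprK.
move: x0; rewrite le_eqVlt => /predU1P[<-|x0].
  (* At 0 the difference quotient has absolute value [|h| ^ (p - 1)], which tends to 0 because p >
     1. *)
  have cv : h^-1 *: (((fun y : R => `|y| `^ p) \o shift 0) (h *: 1) - `|0 : R| `^ p)
      @[h --> 0^'] --> (0 : R).
    apply/cvgr0Pnorm_lt => e e0.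
    have p10 : 0 < p - 1 by rewrite subr_gt0.
    have /cvgr0Pnorm_lt/(_ _ e0) H := cvg_norm_powR0 p10.
    near=> h; have h0 : h != 0 by near: h; exact: nbhs_dnbhs_neq.
    rewrite /= addr0 normr0 powR0 ?gt_eqF ?(lt_trans _ p1)// subr0.
    rewrite /GRing.scale/= mulr1 normrM normfV.
    have -> : `|h|^-1 * `|(`|h| `^ p)| = `|(`|h| `^ (p - 1))|.
      rewrite !(ger0_norm (powR_ge0 _ _)) powRB ?normr_eq0 ?(negPf h0) ?implybT//.
      by rewrite powRr1// mulrC.
    near: h; exact: nbhs_dnbhs H.
  rewrite phi0 mulr0; apply: DeriveDef; first by apply/cvg_ex; exists 0.
  exact/cvg_lim.
have -> : p * phi p x = p * x `^ (p - 1) by rewrite phi_powR.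
apply: (near_eq_is_derive _ (is_derive1_powR p x0)).
near=> y; rewrite ger0_norm//; apply/ltW; near: y; exact: lt_nbhsr.
Unshelve. all: by end_near. Qed.

(** A minimizer may sit at an end of its interval, so only one-sided minimality is available; the
    right difference quotients already determine the sign. *)
Lemma is_derive_ge0 g x l e : is_derive x 1 g l -> 0 < e ->
  (forall y, x <= y < x + e -> g x <= g y) -> 0 <= l.
Proof.
move=> [dg <-] e0 gx; have /cvg_dnbhs_at_right cv := dg.
apply: (cvgr_to_ge cv); near=> h.
have h0 : 0 < h by [].
rewrite /= /GRing.scale/= mulr1 mulr_ge0 ?invr_ge0 ?(ltW h0)// subr_ge0 gx//.
rewrite lerDr (ltW h0)/= addrC ltrD2l.
by near: h; exact: nbhs_right_lt.
Unshelve. all: by end_near. Qed.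

Lemma is_derive_le0 g x l e : is_derive x 1 g l -> 0 < e ->
  (forall y, x - e < y <= x -> g x <= g y) -> l <= 0.
Proof.
move=> dg e0 gx; rewrite -oppr_ge0.
have dN : is_derive (- x) 1 (g \o -%R) (- l).
  rewrite -[- l]mulrN1; apply: is_derive1_comp.
  by rewrite opprK.
apply: (is_derive_ge0 dN e0) => y /andP[xy ye] /=; rewrite opprK gx//.
by rewrite ltrNr lerNl xy opprB addrC ye.
Qed.

Lemma is_derive_primitive (f : int -> R -> R) k x : continuous (f k) ->
  is_derive x 1 (primitive f k) (f k x).
Proof.
move=> cf.
have fi (u v : R) : lebesgue_measure.-integrable `[u, v] (EFin \o f k).
  apply: continuous_compact_integrable; first exact: segment_compact.
  exact: continuous_subspaceT.
(* A base point strictly below both 0 and x lets one integral [G] serve both branches of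
   [primitive], which equals [G t - G 0] near x. *)
pose m := Num.min 0 x - 1.
have m0 : m < 0 by rewrite /m ltrBlDr add0r gt_min ltr01.
have mx : m < x by rewrite /m ltrBlDr gt_min ltrDl ltr01 orbT.
pose G t := \int[lebesgue_measure]_(s in `[m, t]) f k s.
have x1 : x < x + 1 by rewrite ltrDl.
have [dG G'] := continuous_FTC1_closed x1 (fi m (x + 1)) mx (cf x).
have DG : is_derive x 1 (fun t => G t - G 0) (f k x).
  rewrite -[f k x]subr0; apply: is_deriveB.
  by split; [exact: dG|rewrite -derive1E].
have GB (u v : R) : m <= u <= v ->
    G v - G u = \int[lebesgue_measure]_(s in `[u, v]) f k s.
  move=> /andP[mu uv]; rewrite /G Rintegral_itvB//.
  rewrite Rintegral_itv_obnd_cbnd//.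
  apply: integrableS (fi u v) => //; exact: subset_itv_oc_cc.
apply: near_eq_is_derive DG; near=> t.
have mt : m < t by near: t; exact: lt_nbhsr.
rewrite /primitive; case: ifPn => [t0|]; first by rewrite GB// ltW.
by rewrite -ltNge => t0; rewrite -opprB GB// !ltW.
Unshelve. all: by end_near. Qed.

(** * Sums over index sets: minimization, local changes, decay of terms *)

Lemma compact_esum_argmin (T : topologicalType) (I : choiceType) (K : set T)
    (h : T -> I -> R) :
  compact K -> K !=set0 -> (forall i, continuous (h ^~ i)) ->
  exists2 u, K u & forall v, K v ->
    (\esum_(i in [set: I]) (h u i)%:E <= \esum_(i in [set: I]) (h v i)%:E)%E.
Proof.
move=> cK [v0 Kv0] ch.
pose E v := (\esum_(i in [set: I]) (h v i)%:E)%E.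
pose G := filter_from K (fun v => K `&` [set w | (E w <= E v)%E]).
have PG : ProperFilter G.
  apply: filter_from_proper => [|v Kv]; last by exists v; split => //=.
  apply: filter_from_filter => [|v w Kv Kw]; first by exists v0.
  have [vw|/ltW wv] := leP (E v) (E w).
    by exists v => // x [Kx /= xv]; split; split => //=; exact: le_trans vw.
  by exists w => // x [Kx /= xv]; split; split => //=; exact: le_trans wv.
(* A cluster point of the filter of sublevel sets is a minimizer. *)
have [|u [Ku clu]] := cK G PG; first by exists v0 => // x [].
exists u => // v Kv; apply: ge_ereal_sup => _ [A [fA _] <-].
rewrite fsbig_finite//= sumEFin.
(* The sum [E] is the supremum of continuous finite partial sums such as [P]. The sublevel set of
   [E] at [r] lies in the closed set where [P <= r], which therefore contains the cluster point. *)
pose P w := \sum_(i <- finmap.enum_fset (fset_set A)) h w i.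
have cP : continuous P by apply: continuous_big => //; exact: add_continuous.
have PE w : ((P w)%:E <= E w)%E.
  by rewrite /P -sumEFin -fsbig_finite//; apply: ereal_sup_ubound; exists A.
rewrite -/(P u) -/(E v); move Ev : (E v) => [r| |]; last 2 first.
- by rewrite leey.
- by have := PE v; rewrite Ev leeNy_eq.
have clr : closed (P @^-1` [set x | x <= r]).
  by apply: preimage_closed => //; exact: closed_le.
rewrite lee_fin; apply: clr => B nB; apply: clu nB.
exists v => // w [_ /=]; rewrite Ev -lee_fin; exact: le_trans.
Qed.

(** Moving the coordinate k of u changes only the terms k and k + 1 of the energy. Both sides are
    written as additions, so no possibly infinite sum is subtracted. *)
Lemma esum_eq_off_pair (g g' : int -> R) k :
  (forall j, 0 <= g j) -> (forall j, 0 <= g' j) ->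
  (forall j, j != k -> j != k + 1 -> g j = g' j) ->
  (\esum_(j in [set: int]) (g j)%:E + (g' k + g' (k + 1))%:E =
   \esum_(j in [set: int]) (g' j)%:E + (g k + g (k + 1))%:E)%E.
Proof.
move=> g0 g'0 gg'.
pose B : set int := [set k] `|` [set k + 1].
have pair (e : int -> R) : (forall j, 0 <= e j) ->
  (\esum_(j in [set: int]) (e j)%:E =
   (e k + e (k + 1))%:E + \esum_(j in ~` B) (e j)%:E)%E.
  move=> e0; rewrite (esumID B) ?setTI; last by move=> j _; rewrite lee_fin.
  congr (_ + _)%E.
  rewrite esum_fset; last 2 first.
  - by rewrite finite_setU.
  - by move=> j _; rewrite lee_fin.
  rewrite fsbigU//=.
    by rewrite !fsbig_set1.
  by move=> j [/= ->]; lia.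
rewrite (pair g)// (pair g')//.
have -> : (\esum_(j in ~` B) (g j)%:E = \esum_(j in ~` B) (g' j)%:E)%E.
  apply: eq_esum => j /= /not_orP[jk jk1]; rewrite gg'//; exact/eqP.
by rewrite addeAC [RHS]addeAC [X in (X + _)%E]addeC.
Qed.

Lemma esum_term_le (g : int -> R) k : (forall j, 0 <= g j) ->
  ((g k)%:E <= \esum_(j in [set: int]) (g j)%:E)%E.
Proof.
move=> g0; apply: esum_ge; exists [set k]; first by split.
by rewrite fsbig_set1.
Qed.

Lemma esum_lty_cvg0 (g : int -> R) (e : R) : (forall j, 0 <= g j) ->
  (\esum_(j in [set: int]) (g j)%:E < +oo)%E -> 0 < e ->
  \forall k \near int_infty, g k < e.
Proof.
move=> g0 goo e0.
have gfin : (\esum_(j in [set: int]) (g j)%:E)%E \is a fin_num.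
  by rewrite ge0_fin_numE// esum_ge0// => j _; rewrite lee_fin.
have : (\esum_(j in [set: int]) (g j)%:E - e%:E <
        \esum_(j in [set: int]) (g j)%:E)%E.
  by rewrite lteBlDr// lteDl// lte_fin.
(* A finite set [A] carries all but less than [e] of the sum, so no index outside it can have a term
   of size [e]. *)
move=> /ereal_sup_gt[_ [A [fA _] <-] gA].
have [M AM] : exists M : int, forall k, A k -> `|k| < M.
  have /finite_seqP[s ->] := fA; elim: s => [|x s [M ih]]; first by exists 0.
  exists (Num.max M (`|x| + 1)) => k /=; rewrite inE => /predU1P[->|/ih kM].
    by rewrite lt_max ltrDl ltr01 orbT.
  by rewrite lt_max kM.
exists M => // k /= Mk; rewrite ltNge; apply/negP => ek.
have Ak : ~ A k by move=> /AM; rewrite ltNge Mk.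
have : (\sum_(i \in k |` A) (g i)%:E <= \esum_(j in [set: int]) (g j)%:E)%E.
  apply: ereal_sup_ubound; exists (k |` A) => //; split => //.
  by rewrite finite_setU.
rewrite leNgt => /negP; apply.
rewrite fsbigU0//=; last by move=> j [/= ->] /Ak.
rewrite fsbig_set1 addeC.
apply: (@lt_le_trans _ _ (\sum_(i \in A) (g i)%:E + e%:E)%E).
  by rewrite -lteBlDr.
by rewrite leeD2l// lee_fin.
Qed.

(** * The energy on a box and its minimizer *)

Definition box D : set (int -> R) := [set u | forall k, 0 <= u k <= D].

Definition modular_term p a b u k : R :=
  a k * `|Delta u (k - 1)| `^ p + b k * `|u k| `^ p.

(* The shift by lambda * S k, with S k a bound of |F(k, .)| on the box, makes every
   term nonnegative, so that the sum over all k is an [esum]. *)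
Definition energy_term p a b f lambda S u k : R :=
  modular_term p a b u k / p + lambda * (S k - primitive f k (u k)).

Definition energy p a b f lambda S u : \bar R :=
  (\esum_(k in [set: int]) (energy_term p a b f lambda S u k)%:E)%E.

Definition update u (k : int) (s : R) : int -> R :=
  fun j => if j == k then s else u j.

Lemma modular_term_ge0 p a b u k : (forall k, 0 < a k) -> (forall k, 0 < b k) ->
  0 <= modular_term p a b u k.
Proof. by move=> a0 b0; rewrite addr_ge0// mulr_ge0 ?powR_ge0// ltW. Qed.

Lemma continuous_norm_powR p : 1 < p -> continuous (fun x : R => `|x| `^ p).
Proof.
move=> p1 x; apply: differentiable_continuous; apply/derivable1_diffP.
exact: (@ex_derive _ _ _ _ _ _ _ (is_derive_norm_powR x p1)).
Qed.

Lemma continuous_primitive f k : continuous (f k) -> continuous (primitive f k).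
Proof.
move=> cf x; apply: differentiable_continuous; apply/derivable1_diffP.
exact: (@ex_derive _ _ _ _ _ _ _ (is_derive_primitive x cf)).
Qed.

Local Notation product := (prod_topology (fun _ : int => R)).

Lemma energy_argmin p a b f lambda S D : 1 < p -> 0 < D ->
  (forall k, continuous (f k)) ->
  exists2 u, box D u & forall v, box D v ->
    (energy p a b f lambda S u <= energy p a b f lambda S v)%E.
Proof.
move=> p1 D0 cf.
have cproj k : continuous (fun u : product => u k).
  exact: (@proj_continuous int (fun=> R) k).
apply: (@compact_esum_argmin product int (box D)
  (energy_term p a b f lambda S)).
- have := @tychonoff int (fun=> R) (fun=> `[0, D]%classic)
    (fun=> @segment_compact R 0 D).
  by congr (compact _); apply/seteqP; split => u /= H k; move: (H k); rewrite in_itv.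
- by exists (fun=> 0) => k; rewrite lexx ltW.
- move=> k u.
  (* The index [k - 1 + 1] is left unreduced so that the later identity with [energy_term] holds by
     conversion. *)
  pose t1 (v : product) : R := `|v (k - 1 + 1) - v (k - 1)| `^ p.
  pose t2 (v : product) : R := `|v k| `^ p.
  pose t3 (v : product) : R := primitive f k (v k).
  have c1 : {for u, continuous t1}.
    apply: (@continuous_comp _ _ _ (fun v : product => v (k - 1 + 1) - v (k - 1))
      (fun y => `|y| `^ p)).
      exact: (cvgB (cproj (k - 1 + 1) u) (cproj (k - 1) u)).
    exact: continuous_norm_powR.
  have c2 : {for u, continuous t2}.
    apply: (@continuous_comp _ _ _ (fun v : product => v k)
      (fun y => `|y| `^ p)).
      exact: cproj.
    exact: continuous_norm_powR.
  have c3 : {for u, continuous t3}.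
    apply: (@continuous_comp _ _ _ (fun v : product => v k) (primitive f k)).
      exact: cproj.
    exact: continuous_primitive.
  have -> : (energy_term p a b f lambda S)^~ k =
      (fun v => (a k * t1 v + b k * t2 v) / p + lambda * (S k - t3 v)) by [].
  have cc r : {for u, continuous (fun _ : product => r : R)}.
    exact: (@cst_continuous _ _ r u).
  exact: (cvgD (cvgM (cvgD (cvgM (cc (a k)) c1) (cvgM (cc (b k)) c2)) (cc p^-1))
    (cvgM (cc lambda) (cvgB (cc (S k)) c3))).
Qed.

(** * First variation in one coordinate, and the difference equation *)

Definition residual p a b f lambda u k : R :=
  - Delta (fun j => a j * phi p (Delta u (j - 1))) k + b k * phi p (u k)
    - lambda * f k (u k).

Lemma residualE p a b f lambda u k : residual p a b f lambda u k =
  a k * phi p (u k - u (k - 1)) - a (k + 1) * phi p (u (k + 1) - u k)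
  + b k * phi p (u k) - lambda * f k (u k).
Proof. by rewrite /residual /Delta (addrK 1 k) (subrK 1 k); ring. Qed.

(** The value [u k] occurs only in the terms k and k + 1, through [Delta u (k - 1)] and [Delta u k];
    hence [residual] is the partial derivative of the energy in that coordinate. *)
Lemma is_derive_energy p a b f lambda S u k : 1 < p -> continuous (f k) ->
  is_derive (u k) 1 (fun s =>
     energy_term p a b f lambda S (update u k s) k
   + energy_term p a b f lambda S (update u k s) (k + 1))
   (residual p a b f lambda u k).
Proof.
move=> p1 cf.
have p0 : p != 0 by rewrite gt_eqF// (lt_trans _ p1).
pose x := u k; pose y := u (k - 1); pose z := u (k + 1).
(* This collects everything in the two terms that does not involve [s]. *)
pose cst := b (k + 1) * `|z| `^ p / p + lambda * (S (k + 1) - primitive f (k + 1) z)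
            + lambda * S k.
have E : (fun s => energy_term p a b f lambda S (update u k s) k
   + energy_term p a b f lambda S (update u k s) (k + 1)) =
   (fun s => a k / p * `|s - y| `^ p + a (k + 1) / p * `|z - s| `^ p +
     b k / p * `|s| `^ p - lambda * primitive f k s + cst).
  apply/funext => s; rewrite /energy_term /modular_term /Delta /update.
  rewrite (addrK 1 k) (subrK 1 k) !eqxx.
  have -> : (k - 1 == k) = false by lia.
  have -> : (k + 1 == k) = false by lia.
  by rewrite -/y -/z /cst; field.
rewrite E.
have Dy : is_derive x 1 (fun s => `|s - y| `^ p) (p * phi p (x - y) * 1).
  apply: (@is_derive1_comp R (fun s => `|s| `^ p) (fun s => s - y)).
    exact: is_derive_norm_powR.
  rewrite -[X in is_derive _ _ _ X]subr0; exact: is_deriveB.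
have Dz : is_derive x 1 (fun s => `|z - s| `^ p) (p * phi p (z - x) * -1).
  apply: (@is_derive1_comp R (fun s => `|s| `^ p) (fun s => z - s)).
    exact: is_derive_norm_powR.
  rewrite -[X in is_derive _ _ _ X]sub0r; exact: is_deriveB.
have Dx := is_derive_norm_powR x p1.
have DF := is_derive_primitive x cf.
have -> : residual p a b f lambda u k =
   a k / p *: (p * phi p (x - y) * 1) + a (k + 1) / p *: (p * phi p (z - x) * -1)
   + b k / p *: (p * phi p x) - lambda *: f k x + 0.
  by rewrite residualE -/x -/y -/z /GRing.scale/=; field.
apply: is_deriveD; apply: is_deriveB.
Qed.

(** Increasing [u k] stays in the box if [u k < D], decreasing it if [0 < u k]; each admissible
    direction gives one sign of the derivative. *)
Lemma argmin_residual p a b f lambda S D u k : 1 < p -> 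
  (forall k, continuous (f k)) ->
  (forall v j, box D v -> 0 <= energy_term p a b f lambda S v j) ->
  box D u -> (energy p a b f lambda S u < +oo)%E ->
  (forall v, box D v ->
    (energy p a b f lambda S u <= energy p a b f lambda S v)%E) ->
  (u k < D -> 0 <= residual p a b f lambda u k) /\
  (0 < u k -> residual p a b f lambda u k <= 0).
Proof.
move=> p1 cf h0 ubox ufin umin.
have dE := is_derive_energy a b lambda S u p1 (cf k).
have updid : update u k (u k) = u.
  by apply/funext => j; rewrite /update; case: eqP => [->|].
have vmin s : 0 <= s <= D ->
  energy_term p a b f lambda S (update u k (u k)) k
   + energy_term p a b f lambda S (update u k (u k)) (k + 1)
  <= energy_term p a b f lambda S (update u k s) k
   + energy_term p a b f lambda S (update u k s) (k + 1).
  move=> sD; rewrite updid.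
  have vbox : box D (update u k s).
    by move=> j; rewrite /update; case: eqP.
  have := @esum_eq_off_pair (energy_term p a b f lambda S u)
    (energy_term p a b f lambda S (update u k s)) k
    (fun j => h0 _ j ubox) (fun j => h0 _ j vbox).
  have off j : j != k -> j != k + 1 ->
      energy_term p a b f lambda S u j =
      energy_term p a b f lambda S (update u k s) j.
    move=> jk jk1; rewrite /energy_term /modular_term /Delta /update subrK.
    have -> : (j == k) = false by apply/negbTE.
    by have -> : (j - 1 == k) = false by lia.
  move=> /(_ off); rewrite -!/(energy _ _ _ _ _ _ _).
  have := umin _ vbox.
  have : (0 <= energy p a b f lambda S u)%E.
    by apply: esum_ge0 => j _; rewrite lee_fin h0.
  (* The energy of [u] is finite, so the total sums cancel and only the two affected terms are
     compared. *)
  case: (energy p a b f lambda S u) ufin => [e| |] //= _ _.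
  case: (energy p a b f lambda S _) => [e'| |] //=.
  by rewrite lee_fin => ee' []; lra.
split => uk.
  apply: (is_derive_ge0 dE (e := D - u k)); first by rewrite subr_gt0.
  move=> s /andP[us sD]; apply: vmin.
  by rewrite (le_trans _ us) ?(andP (ubox k)).1//=; lra.
apply: (is_derive_le0 dE uk) => s /andP[us sD]; apply: vmin.
by rewrite subrr in us; rewrite (ltW us) (le_trans sD)// (andP (ubox k)).2.
Qed.

Lemma esum_scale_lty (c : R) (g g' : int -> R) : 0 <= c ->
  (forall k, g' k <= c * g k) ->
  (\esum_(k in [set: int]) (g k)%:E < +oo)%E ->
  (\esum_(k in [set: int]) (g' k)%:E < +oo)%E.
Proof.
move=> c0 g'g.
set M := (\esum_(k in [set: int]) (g k)%:E)%E => Moo.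
have M0 : (0 <= M)%E.
  by apply: esum_ge; exists set0; [exact: fsets_set0|rewrite fsbig_set0].
apply: (@le_lt_trans _ _ (c%:E * M)%E); last by rewrite lte_mul_pinfty ?lee_fin.
apply: ge_ereal_sup => _ [A [fA _] <-].
have MA : (\sum_(k \in A) (g k)%:E <= M)%E by apply: ereal_sup_ubound; exists A.
apply: le_trans (lee_wpmul2l _ MA); last by rewrite lee_fin.
rewrite !fsumEFin// -EFinM mulr_fsumr -!fsumEFin//.
by apply: lee_fsum => // k _; rewrite lee_fin.
Qed.

Lemma primitive0 f k : primitive f k 0 = 0 :> R.
Proof. by rewrite /primitive lexx set_itv1 Rintegral_set1. Qed.

Lemma energy_term0 p a b f lambda S k : 1 < p ->
  energy_term p a b f lambda S (fun=> 0) k = lambda * S k.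
Proof.
move=> p1; rewrite /energy_term /modular_term /Delta primitive0 subrr !normr0.
by rewrite powR0 ?gt_eqF ?(lt_trans _ p1)// !mulr0 addr0 mul0r add0r subr0.
Qed.

Lemma energy_term_ge0 p a b f lambda S D u k : 1 < p -> 0 < lambda ->
  (forall k, 0 < a k) -> (forall k, 0 < b k) ->
  (forall t, 0 <= t <= D -> `|primitive f k t| <= S k) ->
  box D u -> 0 <= energy_term p a b f lambda S u k.
Proof.
move=> p1 l0 a0 b0 FS ubox; rewrite addr_ge0//.
  by rewrite divr_ge0 ?modular_term_ge0// ltW// (lt_trans _ p1).
rewrite mulr_ge0 ?(ltW l0)// subr_ge0 (le_trans _ (FS _ (ubox k)))//.
exact: ler_norm.
Qed.

(** The terms of a finite modular tend to 0, and each dominates [b0 * |u k| ^ p]. *)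
Lemma modular_lty_cvg0 p a b (b0 : R) u : 1 < p -> 0 < b0 -> (forall k, 0 < a k) ->
  (forall k, b0 <= b k) -> (modular p a b u < +oo)%E ->
  u @ int_infty --> (0 : R).
Proof.
move=> p1 b00 a0 bb0 moo.
have p0 : 0 < p by exact: lt_trans p1.
have b_gt0 k : 0 < b k by exact: lt_le_trans (bb0 k).
apply/cvgr0Pnorm_lt => e e0.
have be : 0 < b0 * e `^ p by rewrite mulr_gt0// powR_gt0.
have := esum_lty_cvg0 (fun k => modular_term_ge0 p u k a0 b_gt0) moo be.
apply: filterS => k mk; rewrite ltNge; apply/negP => ek.
move: mk; rewrite ltNge => /negP; apply.
apply: (@le_trans _ _ (b k * `|u k| `^ p)); last first.
  by rewrite lerDr mulr_ge0 ?powR_ge0// ltW.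
rewrite ler_pM ?powR_ge0// ?(ltW b00)//.
by apply: ge0_ler_powR; rewrite ?nnegrE// ltW.
Qed.

Lemma exists_box_solution p a b f lambda S D (b0 : R) :
  1 < p -> 0 < lambda -> 0 < D -> 0 < b0 ->
  (forall k, 0 < a k) -> (forall k, b0 <= b k) ->
  (forall k, continuous (f k)) -> (forall k, f k 0 = 0) ->
  (forall k, f k D <= 0) ->
  (forall k t, 0 <= t <= D -> `|primitive f k t| <= S k) ->
  (\esum_(k in [set: int]) (S k)%:E < +oo)%E ->
  exists2 u, box D u & [/\ X p a b u, is_solution p a b f lambda u &
    forall v, box D v ->
      (energy p a b f lambda S u <= energy p a b f lambda S v)%E].
Proof.
move=> p1 l0 D0 b00 a0 bb0 cf f0 fD FS Soo.
have p0 : 0 < p by exact: lt_trans p1.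
have b_gt0 k : 0 < b k by exact: lt_le_trans (bb0 k).
have h0 v j : box D v -> 0 <= energy_term p a b f lambda S v j.
  by move=> vbox; apply: energy_term_ge0 vbox => // t; exact: FS.
have [u ubox umin] := energy_argmin a b lambda S p1 D0 cf.
exists u => //.
(* The zero function is a competitor of finite energy, [lambda] times the sum of [S]. *)
have ufin : (energy p a b f lambda S u < +oo)%E.
  have zbox : box D (fun=> 0) by move=> k; rewrite lexx ltW.
  apply: (le_lt_trans (umin _ zbox)).
  apply: (@esum_scale_lty lambda S) => //; first exact: ltW.
  by move=> k; rewrite energy_term0.
(* Since [S] dominates the primitive on the box, p times an energy term bounds the modular term. *)
have Xu : X p a b u.
  apply: (@esum_scale_lty p (energy_term p a b f lambda S u)) => //.
    exact: ltW.
  move=> k; rewrite -/(modular_term p a b u k) /energy_term mulrDr mulrCA.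
  rewrite divff ?gt_eqF// mulr1.
  rewrite lerDl mulr_ge0 ?(ltW p0)// mulr_ge0 ?(ltW l0)//.
  by rewrite subr_ge0 (le_trans _ (FS k _ (ubox k)))// ler_norm.
split=> //; split; last exact: (modular_lty_cvg0 p1 b00 a0 bb0 Xu).
have res k := argmin_residual k p1 cf h0 ubox ufin umin.
(* At [u k = D] the neighbours are no larger and [f k D <= 0], so all terms of the residual are
   nonnegative and [b k * phi p D] is positive, against the sign given by minimality. *)
have uD k : u k < D.
  have /andP[_] := ubox k; rewrite le_eqVlt => /predU1P[ukD|//].
  have [_] := res k; rewrite ukD => /(_ D0); rewrite residualE ukD.
  have h1 : 0 <= a k * phi p (D - u (k - 1)).
    by rewrite mulr_ge0 ?(ltW (a0 k))// phi_ge0// subr_ge0 (andP (ubox _)).2.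
  have h2 : 0 <= a (k + 1) * phi p (D - u (k + 1)).
    by rewrite mulr_ge0 ?(ltW (a0 _))// phi_ge0// subr_ge0 (andP (ubox _)).2.
  have h3 : 0 < b k * phi p D by rewrite mulr_gt0// phi_gt0.
  have h4 : lambda * f k D <= 0 by rewrite pmulr_rle0.
  rewrite -[u (k + 1) - D]opprB phiN mulrN opprK; lra.
move=> k; apply/eqP; rewrite -subr_eq0; apply/eqP.
rewrite -/(residual p a b f lambda u k).
apply/eqP; rewrite eq_le (res k).1// andbT.
(* At [u k = 0] the neighbours are no smaller and [f k 0 = 0], so the residual is at most 0 although
   no downward move is admissible. *)
have /andP[+ _] := ubox k; rewrite [0 <= u k]le_eqVlt.
move=> /predU1P[uk0|]; last exact: (res k).2.
rewrite residualE -uk0 f0 phi0 sub0r subr0 phiN.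
have h1 : 0 <= a k * phi p (u (k - 1)).
  by rewrite mulr_ge0 ?(ltW (a0 k))// phi_ge0// (andP (ubox _)).1.
have h2 : 0 <= a (k + 1) * phi p (u (k + 1)).
  by rewrite mulr_ge0 ?(ltW (a0 _))// phi_ge0// (andP (ubox _)).1.
by rewrite !mulr0 addr0 subr0 mulrN; lra.
Qed.

(** * Spikes at a single site, and the threshold on [lambda] *)

Lemma energy_spike p a b f lambda S k t : 1 < p -> 0 < lambda -> 0 < t ->
  (forall k, 0 < a k) -> (forall k, 0 < b k) ->
  (forall k s, 0 <= s <= t -> `|primitive f k s| <= S k) ->
  (\esum_(k in [set: int]) (S k)%:E < +oo)%E ->
  (energy p a b f lambda S (update (fun=> 0%R) k t) =
   energy p a b f lambda S (fun=> 0%R) +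
   ((a (k + 1) + a k + b k) * t `^ p / p - lambda * primitive f k t)%R%:E)%E.
Proof.
move=> p1 l0 t0 a0 b0 FS Soo.
have p0 : p != 0 by rewrite gt_eqF// (lt_trans _ p1).
have h0 v j : box t v -> 0 <= energy_term p a b f lambda S v j.
  by move=> vbox; apply: energy_term_ge0 vbox => // s; exact: FS.
have zbox : box t (fun=> 0%R) by move=> j; rewrite lexx ltW.
have vbox : box t (update (fun=> 0%R) k t).
  by move=> j; rewrite /update; case: eqP => _; rewrite lexx ltW.
have := @esum_eq_off_pair (energy_term p a b f lambda S (fun=> 0%R))
  (energy_term p a b f lambda S (update (fun=> 0%R) k t)) k
  (fun j => h0 _ j zbox) (fun j => h0 _ j vbox) _.
have off j : j != k -> j != k + 1 ->
    energy_term p a b f lambda S (fun=> 0%R) j =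
    energy_term p a b f lambda S (update (fun=> 0%R) k t) j.
  move=> jk jk1; rewrite /energy_term /modular_term /Delta /update subrK.
  have -> : (j == k) = false by apply/negbTE.
  by have -> : (j - 1 == k) = false by lia.
move=> /(_ off); rewrite -!/(energy _ _ _ _ _ _ _) !energy_term0//.
(* The jump into the spike costs [a k], its height [b k], and the jump out [a (k + 1)]; this is the
   weight in the denominator of [growth]. *)
have -> : energy_term p a b f lambda S (update (fun=> 0%R) k t) k =
  (a k + b k) * t `^ p / p + lambda * (S k - primitive f k t).
  rewrite /energy_term /modular_term /Delta /update subrK eqxx.
  have -> : (k - 1 == k) = false by lia.
  by rewrite subr0 gtr0_norm// -mulrDl.
have -> : energy_term p a b f lambda S (update (fun=> 0%R) k t) (k + 1) =
  a (k + 1) * t `^ p / p + lambda * S (k + 1).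
  rewrite /energy_term /modular_term /Delta /update (addrK 1 k) eqxx.
  have -> : (k + 1 == k) = false by lia.
  rewrite sub0r normrN gtr0_norm// primitive0 normr0 powR0//.
  by rewrite mulr0 addr0 subr0.
have zfin : (energy p a b f lambda S (fun=> 0%R) < +oo)%E.
  apply: (@esum_scale_lty lambda S) => //; first exact: ltW.
  by move=> j; rewrite energy_term0.
have : (0 <= energy p a b f lambda S (fun=> 0%R))%E.
  by apply: esum_ge0 => j _; rewrite lee_fin h0.
case: (energy p a b f lambda S (fun=> 0%R)) zfin => [z| |] // _ _.
case: (energy p a b f lambda S _) => [v| |] //= [E]; congr EFin.
(* These are the two terms of the zero function at k and k + 1. *)
by apply: (addIr (lambda * S k + lambda * S (k + 1))); rewrite -E; field.
Qed.

Lemma lt_limf_esup (T : choiceType) (U : filteredType T) (h : U -> \bar R)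
    (F : set_system U) (V : set U) (y : \bar R) :
  F V -> (y < limf_esup h F)%E -> exists2 z, V z & (y < h z)%E.
Proof.
move=> FV yh; have : (y < ereal_sup (h @` V))%E.
  by apply: (lt_le_trans yh); apply: ereal_inf_lbound; exists V.
by move=> /ereal_sup_gt[_ [z Vz <-] yz]; exists z.
Qed.

(** All three upper limits send t to infinity, so whichever exceeds [beta] supplies arbitrarily high
    spikes, at a site k that is left free. *)
Lemma lt_Bmax p a b f (beta T : R) : (beta%:E < Bmax p a b f)%E ->
  exists k t, T < t /\ (beta%:E < growth p a b f k t)%E.
Proof.
have nT : pinfty_nbhs R [set t | T < t] by exists T; rewrite num_real.
have joint (F : set_system int) : ProperFilter F ->
    (beta%:E < limf_esup (fun z : dint * R => growth p a b f z.1 z.2)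
      (filter_prod F (pinfty_nbhs R)))%E ->
    exists k t, T < t /\ (beta%:E < growth p a b f k t)%E.
  move=> PF.
  have FV : filter_prod F (pinfty_nbhs R) ([set: int] `*` [set t | T < t]).
    by exists ([set: int], [set t | T < t]) => //=; split => //; exact: filterT.
  by move=> /(lt_limf_esup FV)[[k t] [_ /= Tt] kt]; exists k, t.
rewrite /Bmax !lt_max => /orP[/orP[|]|]; [exact: joint|exact: joint|].
move=> /ereal_sup_gt[_ [k _ <-]] /(lt_limf_esup nT)[t Tt kt].
by exists k, t.
Qed.

Lemma primitive_gt_of_growth p a b f (beta : R) k t : 0 < t ->
  (forall k, 0 < a k) -> (forall k, 0 < b k) ->
  (beta%:E < growth p a b f k t)%E ->
  beta * ((a (k + 1) + a k + b k) * t `^ p) < primitive f k t.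
Proof.
move=> t0 a0 b0; rewrite /growth lte_fin ltr_pdivlMr//.
by rewrite mulr_gt0 ?powR_gt0// !addr_gt0.
Qed.

(** The slack [lambda * beta - p^-1] is what later makes the energy of high spikes arbitrarily
    negative. *)
Lemma threshold_lt_Bmax p lambda (B : \bar R) : 0 < p ->
  (0 < B)%E -> ((B * p%:E)^-1 < lambda%:E)%E ->
  0 < lambda /\ exists2 beta : R, p^-1 < lambda * beta & (beta%:E < B)%E.
Proof.
move=> p0; case: B => [r| |]//; last first.
  (* For an infinite [B] the inverse is 0, so the hypothesis reads [0 < lambda]; the witness below
     gives [lambda * beta = p^-1 + lambda]. *)
  move=> _; rewrite gt0_mulye ?lte_fin// => l0; split => //.
  exists ((lambda * p)^-1 + 1); last exact: ltry.
  by rewrite mulrDr invfM mulVKf ?gt_eqF// mulr1 ltrDl.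
rewrite lte_fin => r0; rewrite -EFinM inver gt_eqF ?mulr_gt0// lte_fin => rl.
have l0 : 0 < lambda by apply: lt_trans rl; rewrite invr_gt0 mulr_gt0.
split => //.
have rp : (p * lambda)^-1 < r.
  rewrite -[r]invrK ltf_pV2 ?posrE ?mulr_gt0 ?invr_gt0//.
  by move: rl; rewrite invfM mulrC ltr_pdivrMl.
(* The midpoint between the critical value of [beta] and the finite value [r] of [B]. *)
exists (((p * lambda)^-1 + r) / 2); last by rewrite lte_fin; lra.
apply: (@le_lt_trans _ _ (lambda * (p * lambda)^-1)).
  by rewrite invfM mulrCA divff ?gt_eqF// mulr1.
by rewrite ltr_pM2l//; lra.
Qed.

(** * Consequences of the hypotheses on [f], and the pointwise bound by the norm *)

Lemma continuous_slice f k : continuous (fun z : dint * R => f z.1 z.2) ->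
  continuous (f k).
Proof.
move=> cf t.
apply: (@continuous_comp _ _ _ (fun s : R => (k : dint, s))
  (fun z : dint * R => f z.1 z.2)).
  exact: (@cvg_pair _ _ _ (nbhs t) (nbhs (k : dint)) (nbhs t) _ _ _
    (fun=> k) id (cvg_cst (k : dint)) cvg_id).
exact: cf.
Qed.

(** The punctured limit says nothing at 0 itself; continuity carries the bound by [|t| ^ (p - 1)],
    which tends to 0, over to that point. *)
Lemma eq0_of_subcritical p (g : R -> R) : 1 < p -> {for 0, continuous g} ->
  (\forall t \near (0 : R)^', `|g t| / `|t| `^ (p - 1) < 1) -> g 0 = 0.
Proof.
move=> p1 cg gt.
have cv : `|g t| - `|t| `^ (p - 1) @[t --> (0 : R)^'] --> `|g 0| - 0.
  apply: cvgB; apply: cvg_trans.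
  - by apply: cvg_app; exact: nbhs_dnbhs.
  - exact: cvg_norm cg.
  - by apply: cvg_app; exact: nbhs_dnbhs.
  - by apply: cvg_norm_powR0; rewrite subr_gt0.
apply/eqP; rewrite -normr_le0 -[`|_|]subr0.
apply: (cvgr_to_le cv).
have tn0 : \forall t \near (0 : R)^', t != 0 by exact: nbhs_dnbhs_neq.
apply: filterS2 gt tn0 => t gt t0.
rewrite subr_le0 ltW//; move: gt; rewrite ltr_pdivrMr ?mul1r//.
by rewrite powR_gt0// normr_gt0.
Qed.

(** The suprema are extended reals; summability makes each of them finite, so their real parts serve
    as [S]. *)
Lemma primitive_summable_bound f (r D : R) : r < 0 -> 0 <= D ->
  (\esum_(k in [set: int])
     ereal_sup [set `|primitive f k t|%:E | t in `[r, D]] < +oo)%E ->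
  exists S : int -> R,
    (forall k t, 0 <= t <= D -> `|primitive f k t| <= S k) /\
    (\esum_(k in [set: int]) (S k)%:E < +oo)%E.
Proof.
move=> r0 D0; set s := (fun k : int => ereal_sup _) => soo.
have le_s k t : 0 <= t <= D -> (`|primitive f k t|%:E <= s k)%E.
  move=> /andP[t0 tD]; apply: ereal_sup_ubound; exists t => //=.
  by rewrite in_itv/= tD (le_trans (ltW r0)).
have s0 k : (0 <= s k)%E.
  by apply: le_trans (le_s k 0 _); rewrite ?lee_fin// lexx.
have sfin k : s k \is a fin_num.
  rewrite ge0_fin_numE//; apply: le_lt_trans soo.
  by apply: esum_ge; exists [set k]; [split|rewrite fsbig_set1].
exists (fun k => fine (s k)); split=> [k t t0D|].
  by rewrite -lee_fin fineK// le_s.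
by under eq_esum do rewrite fineK//.
Qed.

(** This is the embedding of [X] into bounded sequences: a single term of the modular already
    controls [b0 * |u k| ^ p]. *)
Lemma normX_bound p a b (b0 M : R) u k :
  1 < p -> 0 < b0 -> 0 <= M -> (forall k, 0 < a k) -> (forall k, b0 <= b k) ->
  X p a b u -> normX p a b u <= M -> `|u k| <= M / b0 `^ p^-1.
Proof.
move=> p1 b00 M0 a0 bb0 Xu uM.
have p0 : 0 < p by exact: lt_trans p1.
have b_gt0 j : 0 < b j by exact: lt_le_trans (bb0 j).
have m0 : (0 <= modular p a b u)%E.
  by apply: esum_ge0 => j _; rewrite lee_fin modular_term_ge0.
have mfin : modular p a b u \is a fin_num by rewrite ge0_fin_numE.
have : b0 * `|u k| `^ p <= fine (modular p a b u).
  rewrite -lee_fin fineK//.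
  apply: le_trans (esum_term_le k (fun j => modular_term_ge0 p u j a0 b_gt0)).
  rewrite lee_fin; apply: (@le_trans _ _ (b k * `|u k| `^ p)).
    by rewrite ler_wpM2r ?powR_ge0.
  by rewrite lerDr mulr_ge0 ?powR_ge0// ltW.
move=> /(ge0_ler_powR (ltW (_ : 0 < p^-1))).
rewrite invr_gt0 => /(_ p0); rewrite !nnegrE => H.
rewrite ler_pdivlMr ?powR_gt0//; apply: le_trans uM.
apply: le_trans (H _ _); rewrite ?mulr_ge0 ?powR_ge0 ?(ltW b00) ?fine_ge0//.
by rewrite powRM ?powR_ge0 ?(ltW b00)// -powRrM mulfV ?gt_eqF// powRr1// mulrC.
Qed.

End Energy.

(** * Choice of the solutions and divergence of their norms *)

Theorem theorem3 (R : realType) (p : R) (a b : int -> R) (f : int -> R -> R)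
    (c d : nat -> R) (lambda : R)
    (hp : 1 < p)
    (ha : forall k : int, 0 < a k)
    (hb : forall k : int, 0 < b k)
    (hf : continuous (fun z : dint * R => f z.1 z.2))
    (hi_lower : exists b0 : R, 0 < b0 /\ forall k : int, b0 <= b k)
    (hi_infty : b @ int_infty --> +oo)
    (hii : forall eps : R, 0 < eps ->
      \forall t \near (0 : R)^', forall k : int,
        `|f k t| / `|t| `^ (p - 1) < eps)
    (hiii_order : forall n : nat, [/\ 0 < c n, c n < d n & d n < c n.+1])
    (hiii_infty : c @ \oo --> +oo)
    (hiii_sign : forall (k : int) (n : nat) (t : R),
      t \in `[c n, d n] -> f k t <= 0)
    (hiv : exists r : R, r < 0 /\ forall n : nat,
      (\esum_(k in [set: int])
         ereal_sup [set `|primitive f k t|%:E | t in `[r, d n]] < +oo)%E)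
    (hB : (0 < Bmax p a b f)%E)
    (hlambda : ((Bmax p a b f * p%:E)^-1 < lambda%:E)%E) :
  exists u : nat -> int -> R,
    (forall n : nat,
      [/\ X p a b (u n),
          is_solution p a b f lambda (u n) &
          forall k : int, 0 <= u n k]) /\
    (fun n : nat => normX p a b (u n)) @ \oo --> +oo.
Proof.
have p0 : 0 < p by exact: lt_trans hp.
have cf k : continuous (f k) by exact: continuous_slice.
have f0 k : f k 0 = 0.
  apply: (eq0_of_subcritical hp (cf k 0)).
  by apply: filterS (hii 1 ltr01) => t; exact.
have d0 n : 0 < d n by have [c0 cd _] := hiii_order n; exact: lt_trans cd.
have fd n k : f k (d n) <= 0.
  apply: (hiii_sign k n); rewrite in_itv/= lexx andbT.
  by have [_ /ltW] := hiii_order n.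
have [b0 [b00 bb0]] := hi_lower.
have [l0 [beta lbeta betaB]] := threshold_lt_Bmax p0 hB hlambda.
have [r [r0 hiv']] := hiv.
(* Each box gets its own shift [S n]; below, energies with the same shift are compared only through
   their difference from the value at 0. *)
have /choice[S SP] n : exists S : int -> R,
    (forall k t, 0 <= t <= d n -> `|primitive f k t| <= S k) /\
    (\esum_(k in [set: int]) (S k)%:E < +oo)%E.
  exact: primitive_summable_bound r0 (ltW (d0 n)) (hiv' n).
have /choice[u uP] n : exists u : int -> R, box (d n) u /\
    [/\ X p a b u, is_solution p a b f lambda u &
    forall v, box (d n) v ->
      (energy p a b f lambda (S n) u <= energy p a b f lambda (S n) v)%E].
  have [FS Soo] := SP n.
  have [u ubox uP] :=
    exists_box_solution hp l0 (d0 n) b00 ha bb0 cf f0 (fd n) FS Soo.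
  by exists u.
exists u; split=> [n|].
  have [ubox [Xu su _]] := uP n; split=> // k.
  by have /andP[] := ubox k.
have dinfty : d @ \oo --> +oo.
  apply/cvgryPge => A; move/cvgryPge: hiii_infty => /(_ A).
  by apply: filterS => n /le_trans; apply; have [_ /ltW] := hiii_order n.
apply/cvgryPge => M0.
pose M := Num.max M0 0.
have M_ge0 : 0 <= M by rewrite le_max lexx orbT.
(* By [normX_bound], norm at most [M] forces a nonnegative function into the box of height [d m]. *)
have [m dm] : exists m, M / b0 `^ p^-1 <= d m.
  move/cvgryPge: dinfty => /(_ (M / b0 `^ p^-1))[N _ /(_ N)] dN.
  by exists N; apply: dN => /=.
have [FSm Smoo] := SP m.
have lSm : (\esum_(k in [set: int]) (lambda * S m k)%:E < +oo)%E.
  by apply: (@esum_scale_lty _ lambda (S m)) => //; exact: ltW.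
have Sm0 k : 0 <= lambda * S m k.
  rewrite mulr_ge0 ?(ltW l0)// (le_trans _ (FSm k 0 _))//.
  by rewrite lexx ltW.
(* [K] bounds [lambda] times the sum of the primitives along any function in the box of height
   [d m]. *)
pose K := fine (\esum_(k in [set: int]) (lambda * S m k)%:E)%E.
have KE : (\esum_(k in [set: int]) (lambda * S m k)%:E)%E = K%:E.
  by rewrite fineK// ge0_fin_numE// esum_ge0// => k _; rewrite lee_fin.
have K0 : 0 <= K by rewrite -lee_fin -KE esum_ge0// => k _; rewrite lee_fin.
pose gap := lambda * beta - p^-1.
have gap0 : 0 < gap by rewrite subr_gt0.
(* This solves [b0 * gap * T ^ p = K + 1]. Since the weight [A] below is at least [b0], a spike
   higher than [T] lowers the energy by more than [K]. *)
pose T := ((K + 1) / (b0 * gap)) `^ p^-1.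
have [k [t [Tt /(primitive_gt_of_growth _ ha hb) Fkt]]] := lt_Bmax T betaB.
have T0 : 0 <= T by exact: powR_ge0.
have t0 : 0 < t by exact: le_lt_trans Tt.
have {}Fkt := Fkt t0.
set A := a (k + 1) + a k + b k in Fkt.
have Ktp : K + 1 <= b0 * gap * t `^ p.
  rewrite -ler_pdivrMl ?mulr_gt0// mulrC.
  have <- : T `^ p = (K + 1) / (b0 * gap).
    rewrite -powRrM mulVf ?gt_eqF// powRr1// divr_ge0 ?addr_ge0//.
    by rewrite mulr_ge0 ?(ltW b00) ?(ltW gap0).
  exact: (ge0_ler_powR (ltW p0) T0 (ltW t0) (ltW Tt)).
have low : A * t `^ p / p - lambda * primitive f k t < - K.
  have h1 : lambda * (beta * (A * t `^ p)) < lambda * primitive f k t.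
    by rewrite ltr_pM2l.
  have h2 : b0 * gap * t `^ p <= A * gap * t `^ p.
    rewrite ler_wpM2r ?powR_ge0// ler_wpM2r ?(ltW gap0)//.
    by rewrite /A (le_trans (bb0 k))// lerDr addr_ge0// ltW.
  have h3 : A * t `^ p / p = lambda * (beta * (A * t `^ p)) - A * gap * t `^ p.
    by rewrite /gap; ring.
  by rewrite h3; lra.
(* From here n is so large that the spike fits in the box of height [d n]; a norm below [M] is to be
   refuted. *)
move/cvgryPge: dinfty => /(_ t); apply: filterS => n tdn.
rewrite (@le_trans _ _ M) ?le_max ?lexx// leNgt; apply/negP => uM.
have [FSn Snoo] := SP n; have [ubox [Xu su umin]] := uP n.
have vbox : box (d n) (update (fun=> 0) k t).
  move=> j; rewrite /update; case: eqP => _; rewrite ?tdn ?(ltW t0)//.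
  by rewrite lexx (ltW (d0 n)).
have FSt j s : 0 <= s <= t -> `|primitive f j s| <= S n j.
  by move=> /andP[s0 st]; apply: FSn; rewrite s0 (le_trans st).
have := umin _ vbox; rewrite (energy_spike k hp l0 t0 ha hb FSt Snoo).
have zbox : box (d n) (fun=> 0) by move=> j; rewrite lexx ltW.
have h0 v j : box (d n) v -> 0 <= energy_term p a b f lambda (S n) v j.
  by move=> vb; apply: energy_term_ge0 vb => // s; exact: FSn.
(* A norm below [M] confines [u n] to the box of height [d m], so its energy lies at most [K] below
   the value at 0; the spike lies more than [K] below, contradicting minimality. *)
have : (energy p a b f lambda (S n) (fun=> 0%R) <=
    energy p a b f lambda (S n) (u n) + K%:E)%E.
  rewrite -KE -esumD; last 2 first.
  - by move=> j _; rewrite lee_fin h0.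
  - by move=> j _; rewrite lee_fin.
  apply: le_esum => j _; rewrite -EFinD lee_fin energy_term0// /energy_term.
  have ujm : 0 <= u n j <= d m.
    have /andP[-> _] := ubox j; rewrite (le_trans (ler_norm _))// (le_trans _ dm)//.
    exact: normX_bound hp b00 M_ge0 ha bb0 Xu (ltW uM).
  have h1 : 0 <= modular_term p a b (u n) j / p.
    by rewrite divr_ge0 ?modular_term_ge0// ltW.
  have h2 : lambda * primitive f j (u n j) <= lambda * S m j.
    by rewrite ler_pM2l// (le_trans (ler_norm _))// FSm.
  by rewrite mulrBr; lra.
have : (energy p a b f lambda (S n) (fun=> 0%R) < +oo)%E.
  apply: (@esum_scale_lty _ lambda (S n)) => //; first exact: ltW.
  by move=> j; rewrite energy_term0.
have : (0 <= energy p a b f lambda (S n) (fun=> 0%R))%E.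
  by apply: esum_ge0 => j _; rewrite lee_fin h0.
have : (0 <= energy p a b f lambda (S n) (u n))%E.
  by apply: esum_ge0 => j _; rewrite lee_fin h0.
case: (energy p a b f lambda (S n) (fun=> 0)) => [z| |] //.
case: (energy p a b f lambda (S n) (u n)) => [e| |] //.
rewrite -!EFinD !lee_fin -/A; lra.
Qed.
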